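(* The only Type 1 triangle which is a $T_1(k,4,d)$ is the triangle $T_1(2,4,3)$, which has side lengths $9$, $12$ and $15$. That is, for integers $k\geq 2$ and $2\leq d\leq 3$, there exists a Pythagorean triangle with one leg of length $d^k$ and hypotenuse of length $d_{k,4}=\dfrac{d\,(4^k-1)}{3}$ if and only if $k=2$ and $d=3$, and in that case the triangle has side lengths $9,12,15$.
   Context: A Pythagorean triangle is a right triangle all of whose side lengths are positive integers. For integers $b\geq 3$, $2\leq d\leq b-1$ and $k\geq 2$, $d_{k,b}=d\,(b^{k-1}+\cdots+b+1)=\dfrac{d(b^k-1)}{b-1}$ denotes the positive integer whose base $b$ representation consists of $k$ digits all equal to $d$. A Pythagorean triangle is a Type 1 triangle with base $b$ repeated digits, denoted $T_1(k,b,d)$ (with $b\geq 3$, $2\leq d\leq b-1$, $k\geq 2$), if one of its two legs has length $d^k$ and its hypotenuse has length $d_{k,b}$. *)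

(* Defs.v *)
From mathcomp Require Import all_boot.

Set Implicit Arguments.
Unset Strict Implicit.
Unset Printing Implicit Defensive.

(* x and y are the legs, z is the hypotenuse. *)
Definition pythagorean_triangle (x y z : nat) : Prop :=
  [/\ 0 < x, 0 < y, 0 < z & x ^ 2 + y ^ 2 = z ^ 2].

(* d_{k,b} : the number written in base b with k digits all equal to d. *)
Definition repdigit (k b d : nat) : nat := d * \sum_(i < k) b ^ i.

Lemma repdigitE (k b d : nat) :
  1 < b -> repdigit k b d = (d * (b ^ k - 1)) %/ (b - 1).
Proof.
move=> b1; rewrite /repdigit !subn1 predn_exp mulnCA mulKn //.
by rewrite -subn1 subn_gt0.
Qed.

(* The triangle with legs x, y (in either order) and hypotenuse z is a
   T_1(k,b,d). *)
Definition type1_triangle (k b d x y z : nat) : Prop :=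
  [/\ 3 <= b, 2 <= d <= b - 1 & 2 <= k] /\
  [/\ pythagorean_triangle x y z,
      x = d ^ k \/ y = d ^ k
    & z = repdigit k b d].

(* Main.v *)
Require Import Defs.
From mathcomp Require Import all_boot.
From mathcomp Require Import zify.

Set Implicit Arguments.
Unset Strict Implicit.
Unset Printing Implicit Defensive.

(** Write the Pythagorean relation as (z - y)(z + y) = (d ^ k) ^ 2, where y is
    the leg other than d ^ k and z the hypotenuse.

    For d = 2 the left-hand side is at least 2 z - 1, because y < z, whereas the
    repdigit z is about (2 / 3) 4 ^ k: a leg of length 2 ^ k is too short for
    such a hypotenuse ([leq_double_hypotenuse]).

    For d = 3 the hypotenuse is z = 4 ^ k - 1, and both factors are powers of 3.
    The smaller one, z - y, divides their sum 2 z, hence divides 4 ^ k - 1.  The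
    3-adic valuation of 4 ^ k - 1 is at most one more than that of k
    ([dvdn_3exp_4exp_pred]), so z - y <= 3 k.  As z + y < 2 * 4 ^ k, this
    forces 9 ^ k <= 6 k 4 ^ k, which leaves k = 2 and k = 3
    ([ltn_6k4exp_9exp]).  For k = 3 the other leg would be the square root of
    63 ^ 2 - 27 ^ 2 = 3240, which is not an integer. *)

(** * The other leg *)

Lemma type1_triangle_other_leg k b d x y z :
  type1_triangle k b d x y z ->
  exists2 t, 0 < t & (d ^ k) ^ 2 + t ^ 2 = (repdigit k b d) ^ 2.
Proof.
move=> [_ [[x0 y0 _ xyz] xd <-]].
case: xd => <-; first by exists y.
by exists x => //; rewrite addnC.
Qed.

(** The square of a leg is z ^ 2 minus a smaller square, and the largest square
    below z ^ 2 is already 2 z - 1 away from it. *)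
Lemma leq_double_hypotenuse a y z :
  0 < a -> a ^ 2 + y ^ 2 = z ^ 2 -> z.*2 <= (a ^ 2).+1.
Proof.
move=> a0 ayz.
have yz : y < z by rewrite -ltn_sqr -ayz -[X in X < _]add0n ltn_add2r expn_gt0 a0.
nia.
Qed.

(** * Repdigits in base 4 *)

Lemma repdigit_4_3 k : repdigit k 4 3 = (4 ^ k).-1.
Proof. by rewrite predn_exp. Qed.

Lemma ltn_4exp_double_repdigit_4_2 k :
  2 <= k -> (4 ^ k).+1 < (repdigit k 4 2).*2.
Proof.
case: k => [|[|k]] // _.
rewrite /repdigit big_ord_recr big_ord_recl /= expn0 !expnS.
by move: (\sum_(i < k) _) (4 ^ k) => s f; lia.
Qed.

(** * Powers of 3 dividing 4 ^ k - 1 *)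

Lemma modn_4exp_3 k : 4 ^ k %% 3 = 1.
Proof. by rewrite -modnXm exp1n. Qed.

(** The order of 4 modulo 9 is 3. *)
Lemma dvdn_9_4exp_pred k : 9 %| (4 ^ k).-1 -> 3 %| k.
Proof.
rewrite {1}(divn_eq k 3) expnD (mulnC (k %/ 3)) expnM.
have -> : (4 ^ 3) ^ (k %/ 3) = 9 * ((4 ^ 3) ^ (k %/ 3) %/ 9) + 1.
  by rewrite {1}(divn_eq ((4 ^ 3) ^ (k %/ 3)) 9) mulnC -modnXm exp1n.
rewrite /dvdn; have := ltn_pmod k (isT : 0 < 3).
case: (k %% 3) => [|[|[|r]]] // _; rewrite ?expn1 ?expnS ?expn0; lia.
Qed.

(** Passing from j to 3 j multiplies 4 ^ j - 1 by x ^ 2 + x + 1 with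
    x = 4 ^ j = 1 + 3 t, that is by 3 (1 + 3 (t + t ^ 2)): exactly one factor
    3 is gained. *)
Lemma dvdn_3exp_4exp_pred m k : 3 ^ m.+1 %| (4 ^ k).-1 -> 3 ^ m %| k.
Proof.
elim: m k => [|m IHm] k // mk.
have /dvdnP[j kj] : 3 %| k.
  apply: dvdn_9_4exp_pred; apply: dvdn_trans mk.
  by rewrite (dvdn_exp2l 3 (_ : 2 <= m.+2)).
rewrite {}kj in mk *.
rewrite expnSr dvdn_pmul2r //; apply: IHm.
pose t := 4 ^ j %/ 3.
have xt : 4 ^ j = (3 * t).+1.
  by rewrite (divn_eq (4 ^ j) 3) modn_4exp_3 addn1 mulnC.
have factor : (4 ^ (j * 3)).-1 = (4 ^ j).-1 * (3 * (t + t ^ 2)).+1 * 3.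
  by rewrite expnM xt /= !expnS expn0; nia.
move: mk; rewrite factor expnSr dvdn_pmul2r // Gauss_dvdl //.
by rewrite coprimeXl // /coprime -[X in gcdn _ X]addn1 mulnC gcdnMDl.
Qed.

Lemma ltn_6k4exp_9exp k : 4 <= k -> 6 * k * 4 ^ k < 9 ^ k.
Proof.
elim: k => // k IHk; rewrite leq_eqVlt => /orP[/eqP<- //|].
rewrite ltnS => k4; have := IHk k4; rewrite !expnS; nia.
Qed.

(** * Digit 3 *)

Lemma type1_4_3_leq3 k y :
  0 < y -> (3 ^ k) ^ 2 + y ^ 2 = ((4 ^ k).-1) ^ 2 -> k <= 3.
Proof.
move=> y0 kyz; rewrite leqNgt; apply/negP => k4.
set z := (4 ^ k).-1 in kyz.
have f0 : 0 < 4 ^ k by rewrite expn_gt0.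
have yz : y <= z by rewrite -leq_sqr -kyz leq_addl.
have prod : (z - y) * (z + y) = 3 ^ (k * 2).
  by rewrite -subn_sqr -kyz addnK expnM.
have /(dvdn_pfactor _ _ (isT : prime 3))[m _ zy] : z - y %| 3 ^ (k * 2).
  by rewrite -prod dvdn_mulr.
have /(dvdn_pfactor _ _ (isT : prime 3))[n _ zy'] : z + y %| 3 ^ (k * 2).
  by rewrite -prod dvdn_mull.
have mn : 3 ^ m %| 3 ^ n.
  by apply/dvdn_exp2l; rewrite -(leq_exp2l _ _ (isT : 1 < 3)) -zy -zy'; lia.
have mz : 3 ^ m %| z.
  have m2z : 3 ^ m %| 2 * z.
    have -> : 2 * z = 3 ^ m + 3 ^ n by rewrite -zy -zy'; lia.
    exact: dvdn_add.
  by rewrite Gauss_dvdr // coprimeXl in m2z.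
have m3k : 3 ^ m <= 3 * k.
  case: m mz {zy mn} => [_|m mz]; first by rewrite expn0; lia.
  rewrite expnS leq_pmul2l //; apply: dvdn_leq; first by lia.
  exact: dvdn_3exp_4exp_pred.
have := ltn_6k4exp_9exp k4; rewrite ltnNge => /negP[].
rewrite -[9]/(3 ^ 2) -expnM [2 * k]mulnC -prod zy.
have -> : 6 * k * 4 ^ k = (3 * k) * (2 * 4 ^ k) by lia.
by apply: leq_mul => //; lia.
Qed.

Lemma leg_9_hypotenuse_15 y : 9 ^ 2 + y ^ 2 = 15 ^ 2 -> y = 12.
Proof. by move=> h; apply/eqP; rewrite -(eqn_exp2r _ _ (isT : 0 < 2)); lia. Qed.

Lemma type1_triangle_4_digit k d x y z :
  2 <= d <= 3 -> type1_triangle k 4 d x y z -> k = 2 /\ d = 3.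
Proof.
move=> dle T; have [[_ _ k2] _] := T.
have [t t0] := type1_triangle_other_leg T.
have /orP[/eqP->|/eqP->] : (d == 2) || (d == 3) by lia.
  move/leq_double_hypotenuse; rewrite expn_gt0 -expnM mulnC expnM => /(_ isT).
  by rewrite leqNgt ltn_4exp_double_repdigit_4_2.
rewrite repdigit_4_3 => tz; have k3 := type1_4_3_leq3 t0 tz.
split=> //; have /orP[/eqP //|/eqP k_eq3] : (k == 2) || (k == 3) by lia.
(* 56 ^ 2 = 3136 and 57 ^ 2 = 3249 enclose 3240. *)
have tt : t ^ 2 = 3240 by move: tz; rewrite k_eq3 /=; lia.
have t_gt56 : 56 < t by rewrite -ltn_sqr tt.
have t_lt57 : t < 57 by rewrite -ltn_sqr tt.
by lia.
Qed.

Theorem theorem2 :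
  (forall k d : nat, 2 <= k -> 2 <= d <= 3 ->
     ((exists x y z : nat, type1_triangle k 4 d x y z) <-> k = 2 /\ d = 3)) /\
  (forall x y z : nat,
     type1_triangle 2 4 3 x y z <->
     (x = 9 /\ y = 12 \/ x = 12 /\ y = 9) /\ z = 15).
Proof.
have sides x y z : type1_triangle 2 4 3 x y z <->
    (x = 9 /\ y = 12 \/ x = 12 /\ y = 9) /\ z = 15.
  rewrite /type1_triangle repdigit_4_3; split.
    move=> [_ [[_ _ _ xyz] xd zE]]; rewrite {}zE in xyz *; split=> //.
    case: xd xyz => -> xyz; [left | right]; split=> //.
      exact: leg_9_hypotenuse_15.
    by apply: leg_9_hypotenuse_15; rewrite addnC.
  move=> [xy ->]; split=> //.
  by case: xy => -[-> ->]; split=> //; [left | right].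
split=> // k d _ dle; split=> [[x [y [z]]]|[-> ->]].
  exact: type1_triangle_4_digit.
by exists 9, 12, 15; apply/sides; split=> //; left.
Qed.
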